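(* Let $\mathcal G=(\mathcal V,\mathcal E)$ be a bipartite graph and $\mathcal A$ a finite alphabet. Let $Gr\subset Aut(\mathcal G)$ be a subgroup, $X\subset\mathcal A^{\mathcal V}$ a $Gr$-invariant n.n.constraint space, and $X_a$ a strong config-fold of $X$ for some $a\in\mathcal A$. Suppose $M\in\mathbf M^{Gr}_X$ is a $Gr$-invariant Markov cocycle. Then $M\in\mathbf G^{Gr}_X$ if and only if $M|_{\Delta_{X_a}}\in\mathbf G^{Gr}_{X_a}$.
   Context: Graphs: a graph $\mathcal G=(\mathcal V,\mathcal E)$ is a countable, locally finite, undirected graph without self-loops or multiple edges; $\sim$ denotes adjacency, $d_{\mathcal G}$ graph distance. For $F\subset\mathcal V$, $\partial F=\{u\in\mathcal V\setminus F: u\sim v\text{ for some }v\in F\}$, and $D_n(v)=\{w: d_{\mathcal G}(v,w)\le n\}$. A clique is a finite set of pairwise adjacent vertices (single vertices included). $Aut(\mathcal G)$ is the group of adjacency-preserving bijections of $\mathcal V$ (in both directions). Configurations: $\mathcal A^{\mathcal V}$ has the product topology, patterns are elements of $\mathcal A^F$, $F\subset \mathcal V$. For closed $X\subset\mathcal A^{\mathcal V}$, $\mathcal L_F(X)=\{x|_F:x\in X\}$ and $\mathcal L(X)=\bigcup_{F\text{ finite}}\mathcal L_F(X)$. $\langle a,c\rangle_{\{v,w\}}$ is the pattern with value $a$ at $v$ and $c$ at $w$; $b^F$ is the pattern on $F$ constantly $b$. An n.n.constraint space is a set of the form $\{x\in\mathcal A^{\mathcal V}:\text{ no pattern from }\mathcal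 F\text{ appears in }x\}$ where $\mathcal F$ is a set of patterns on cliques. Group action: for $g\in Aut(\mathcal G)$, $(gx)_v=x_{g^{-1}v}$, and for $\alpha\in\mathcal A^F$, $g\alpha\in\mathcal A^{gF}$ is $(g\alpha)_{gv}=\alpha_v$. $X$ is $Gr$-invariant if $gX=X$ for all $g\in Gr$. On interactions $gV(\alpha)=V(g^{-1}\alpha)$; $V$ is $Gr$-invariant if $gV=V$ for all $g\in Gr$. Cocycles: $\Delta_X=\{(x,y)\in X\times X: x,y\text{ differ at finitely many sites}\}$. A $\Delta_X$-cocycle is $M:\Delta_X\to\mathbb R$ with $M(x,z)=M(x,y)+M(y,z)$ for $(x,y),(y,z)\in\Delta_X$. It is a Markov cocycle if $M(x,y)$ depends only on $x|_{F\cup\partial F}$ and $y|_{F\cup\partial F}$, where $F$ is the set of sites where $x$ and $y$ differ. It is $Gr$-invariant if $M(gx,gy)=M(x,y)$ for all $g\in Gr$. A nearest neighbour interaction on $X$ is $V:\mathcal L(X)\to\mathbb R$ vanishing on patterns on finite sets that are not cliques. The Gibbs cocycle with interaction $V$ is $M(x,y)=\sum_{A\subset\mathcal V\text{ finite}}\big(V(y|_A)-V(x|_A)\big)$. $\mathbf M^{Gr}_X$ is the space of $Gr$-invariant Markov cocycles on $X$, and $\mathbf G^{Gr}_X$ is the space of Gibbs cocycles on $X$ with $Gr$-invariant nearest neighbour interactions. Folding: let $X\subset\mathcal A^{\mathcal V}$ be an n.n.constraint space on bipartite $\mathcal G$, and $a,b\in\mathcal A$ distinct. $a$ can be strongly config-folded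 into $b$ if for all edges $(v_1,v_2),(v_2,v_3)\in\mathcal E$ and all $c\in\mathcal A$, $\langle a,c\rangle_{\{v_1,v_2\}}\in\mathcal L_{\{v_1,v_2\}}(X)$ implies $\langle b,c\rangle_{\{v_1,v_2\}}\in\mathcal L_{\{v_1,v_2\}}(X)$, $\langle c,b\rangle_{\{v_2,v_3\}}\in\mathcal L_{\{v_2,v_3\}}(X)$ and $b^{\partial D_1(v_1)}\in\mathcal L_{\partial D_1(v_1)}(X)$. In that case (for some such $b$) $X_a:=X\cap(\mathcal A\setminus\{a\})^{\mathcal V}$ is called a strong config-fold of $X$.
   Formalization: The formal theorem adds that X_a is nonempty whenever X is; this is automatic if the graph has no isolated vertices. Without it the claim fails, e.g. for 3-colourings of Z^2 plus an isolated vertex forced to carry a, where X_a is empty and the height cocycle is not Gibbs. *)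

(* Defs.v *)
From HB Require Import structures.
From mathcomp Require Import all_boot all_algebra.
From mathcomp Require Import all_classical all_reals.

Set Implicit Arguments.
Unset Strict Implicit.
Unset Printing Implicit Defensive.

Import GRing.Theory.
Local Open Scope classical_set_scope.
Local Open Scope ring_scope.

Record graph := Graph {
  vertex :> countType;
  adj : rel vertex;
  adj_sym : symmetric adj;
  adj_irr : irreflexive adj;
  adj_locally_finite : forall v, finite_set [set w | adj v w] }.

Arguments adj {g} : rename.

Section Graphs.
Variable G : graph.
Implicit Types (u v w : G) (F C : set G).

Definition bipartite : Prop :=
  exists side : G -> bool, forall u v, adj u v -> side u != side v.

Definition boundary F : set G :=
  [set u | ~ F u /\ exists2 v, F v & adj u v].

(* A walk of length at most [n] from [v] to [w] exists iff the graph distance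
   is at most [n]; vertices in different components are at infinite distance. *)
Definition gball (n : nat) v : set G :=
  [set w | exists2 p : seq G, path adj v p & last v p = w /\ (size p <= n)%N].

(* The empty set counts as a clique; this affects neither the class of
   constraint spaces nor the class of Gibbs cocycles. *)
Definition is_clique C : Prop :=
  finite_set C /\ forall u v, C u -> C v -> u != v -> adj u v.

Record graph_aut := GraphAut {
  aut_fun :> G -> G;
  aut_finv : G -> G;
  aut_funK : cancel aut_fun aut_finv;
  aut_finvK : cancel aut_finv aut_fun;
  aut_adj : forall u v, adj (aut_fun u) (aut_fun v) = adj u v }.

Lemma graph_aut_eq (g h : graph_aut) : g =1 h -> g = h.
Proof.
move=> /funext; case: g h => [g g' gK g'K ga] [h h' hK h'K ha] /= gh.
rewrite {}gh in gK g'K ga *.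
have e : g' = h' by apply/funext => v; rewrite -[v in LHS]h'K gK.
by rewrite {}e in gK g'K *; congr GraphAut; exact: Prop_irrelevance.
Qed.

Definition aut_id : graph_aut :=
  @GraphAut id id (fun=> erefl) (fun=> erefl) (fun _ _ => erefl).

Lemma aut_comp_adj (g h : graph_aut) u v :
  adj ((g \o h) u) ((g \o h) v) = adj u v.
Proof. by rewrite /= !aut_adj. Qed.

Definition aut_comp (g h : graph_aut) : graph_aut :=
  GraphAut (can_comp (aut_funK g) (aut_funK h))
    (can_comp (aut_finvK h) (aut_finvK g)) (aut_comp_adj g h).

Lemma aut_finv_adj (g : graph_aut) u v :
  adj (aut_finv g u) (aut_finv g v) = adj u v.
Proof. by rewrite -(aut_adj g) !aut_finvK. Qed.

Definition aut_inv (g : graph_aut) : graph_aut :=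
  GraphAut (aut_finvK g) (aut_funK g) (aut_finv_adj g).

HB.instance Definition _ := gen_eqMixin graph_aut.
HB.instance Definition _ := gen_choiceMixin graph_aut.

Fact aut_compA : associative aut_comp.
Proof. by move=> g h k; apply: graph_aut_eq. Qed.
Fact aut_comp1l : left_id aut_id aut_comp.
Proof. by move=> g; apply: graph_aut_eq. Qed.
Fact aut_comp1r : right_id aut_id aut_comp.
Proof. by move=> g; apply: graph_aut_eq. Qed.
Fact aut_compVl : left_inverse aut_id aut_inv aut_comp.
Proof. by move=> g; apply: graph_aut_eq => v /=; rewrite aut_funK. Qed.
Fact aut_compVr : right_inverse aut_id aut_inv aut_comp.
Proof. by move=> g; apply: graph_aut_eq => v /=; rewrite aut_finvK. Qed.

HB.instance Definition _ := isGroup.Build graph_aut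
  aut_compA aut_comp1l aut_comp1r aut_compVl aut_compVr.

End Graphs.

Section Configurations.
Variables (G : graph) (A : finType).

Definition config := G -> A.

(* A pattern in A^F is a partial function: [Some] on F and [None] off F. *)
Definition pattern := G -> option A.

Implicit Types (F : set G) (x y : config) (p q : pattern) (X : set config).

Definition pdom p : set G := [set v | p v <> None].

Definition restr F x : pattern := fun v => if v \in F then Some (x v) else None.

Definition const_pat F (b : A) : pattern :=
  fun v => if v \in F then Some b else None.

Definition pat2 (v : G) (a : A) (w : G) (c : A) : pattern :=
  fun u => if u == v then Some a else if u == w then Some c else None.

Definition language_on F X : set pattern := [set restr F x | x in X].

Definition language X : set pattern :=
  \bigcup_(F in [set F : set G | finite_set F]) language_on F X.

Definition appears p x : Prop := restr (pdom p) x = p.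

Definition nn_constraint_space X : Prop :=
  exists2 forbidden : set pattern,
    (forall p, forbidden p -> is_clique (pdom p)) &
    X = [set x | forall p, forbidden p -> ~ appears p x].

(* Used both for configurations (T = A) and for patterns (T = option A). *)
Definition act (T : Type) (g : graph_aut G) (x : G -> T) : G -> T :=
  fun v => x ((g^-1)%g v).

Definition invariant_space (Gr : set (graph_aut G)) X : Prop :=
  forall g, Gr g -> act g @` X = X.

Definition diff_sites x y : set G := [set v | x v <> y v].

Definition Delta X x y : Prop := [/\ X x, X y & finite_set (diff_sites x y)].

Definition strongly_foldable X (a b : A) : Prop :=
  a != b /\
  forall (v1 v2 v3 : G) (c : A), adj v1 v2 -> adj v2 v3 ->
    language_on [set v1; v2] X (pat2 v1 a v2 c) ->
    [/\ language_on [set v1; v2] X (pat2 v1 b v2 c),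
        language_on [set v2; v3] X (pat2 v2 c v3 b) &
        language_on (boundary (gball 1 v1)) X
          (const_pat (boundary (gball 1 v1)) b)].

Definition config_fold X (a : A) : set config := X `&` [set x | forall v, x v != a].

End Configurations.

Arguments config : clear implicits.
Arguments pattern : clear implicits.

(* Functions on Delta_X (resp. on the language of X) are total functions of
   which only the values on Delta_X (resp. on the language) are used.  Hence
   the restriction of M to Delta_Y for Y included in X is M itself, seen
   relatively to Y. *)
Section Cocycles.
Variables (R : realType) (G : graph) (A : finType).
Implicit Types (X : set (config G A)) (M : config G A -> config G A -> R).
Implicit Types (U : pattern G A -> R) (Gr : set (graph_aut G)).

Definition cocycle X M : Prop :=
  forall x y z, Delta X x y -> Delta X y z -> M x z = M x y + M y z.

Definition markov X M : Prop :=
  forall x y x' y', Delta X x y -> Delta X x' y' ->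
    let F := diff_sites x y in
    diff_sites x' y' = F ->
    {in F `|` boundary F, x =1 x'} -> {in F `|` boundary F, y =1 y'} ->
    M x y = M x' y'.

Definition invariant_cocycle Gr X M : Prop :=
  forall g, Gr g -> forall x y, Delta X x y -> M (act g x) (act g y) = M x y.

Definition markov_cocycles Gr X : set (config G A -> config G A -> R) :=
  [set M | [/\ cocycle X M, markov X M & invariant_cocycle Gr X M]].

Definition nn_interaction X U : Prop :=
  forall p, language X p -> ~ is_clique (pdom p) -> U p = 0.

Definition invariant_interaction Gr X U : Prop :=
  forall g, Gr g -> forall p, language X p -> U (act (g^-1)%g p) = U p.

(* On Delta_X only the finitely many cliques B meeting [diff_sites x y] contribute
   when U is a nearest neighbour interaction. *)
Definition gibbs_cocycle U (x y : config G A) : R :=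
  \sum_(B \in [set B : set G | finite_set B]) (U (restr B y) - U (restr B x)).

Definition gibbs_cocycles Gr X : set (config G A -> config G A -> R) :=
  [set M | exists U, [/\ nn_interaction X U, invariant_interaction Gr X U &
    forall x y, Delta X x y -> M x y = gibbs_cocycle U x y]].

End Cocycles.
Arguments markov_cocycles {R G A}.
Arguments gibbs_cocycles {R G A}.

Section FoldNonempty.
Variables (G : graph) (A : finType) (X : set (config G A)) (a b : A).
Hypotheses (G_bip : bipartite G) (noniso : forall v : G, exists w, adj v w).
Hypothesis ab : strongly_foldable X a b.

Let f c := if c == a then b else c.

Fact fold_step (v w : G) x : adj v w -> X x -> x v = a ->
  exists2 z, X z & z v = b /\ z w = x w.
Proof.
move=> vw Xx xva; have vNw : w == v = false.
  by apply/eqP => e; rewrite e adj_irr in vw.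
have wv : adj w v by rewrite adj_sym.
have [|[z Xz zE] _ _] := ab.2 v w v (x w) vw wv.
  exists x => //; apply/funext => u; rewrite /restr /pat2.
  have [->|uv] := eqVneq u v; first by rewrite xva mem_set//; left.
  have [->|uw] := eqVneq u w; first by rewrite mem_set//; right.
  by rewrite memNset// => -[] /eqP; exact/negP.
exists z => //; split.
  move: (congr1 (@^~ v) zE); rewrite /restr /pat2 eqxx mem_set; last by left.
  by move=> [].
move: (congr1 (@^~ w) zE); rewrite /restr /pat2 eqxx vNw mem_set; last by right.
by move=> [].
Qed.

Fact fold_edge (v w : G) x : adj v w -> X x ->
  exists2 z, X z & z v = f (x v) /\ z w = f (x w).
Proof.
move=> vw Xx; have [y Xy [yv yw]] : exists2 y, X y & y v = f (x v) /\ y w = x w.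
  rewrite /f; case: eqP => [xva|_]; last by exists x.
  exact: fold_step.
rewrite -yw /f; have [ywa|_] := eqVneq (y w) a; last by exists y.
have [z Xz [zw zv]] := @fold_step w v y (etrans (adj_sym _ _) vw) Xy ywa.
by exists z => //; rewrite zw zv yv.
Qed.

Fact fold_clique (C : set G) x : is_clique C -> X x ->
  exists2 z, X z & {in C, z =1 f \o x}.
Proof.
move=> [_ cC] Xx; have [->|/set0P[v Cv]] := eqVneq C set0.
  by exists x => // u; rewrite in_set0.
have [[w [Cw vw]]|noC] := pselect (exists w, C w /\ v != w).
  have [z Xz [zv zw]] := fold_edge (cC _ _ Cv Cw vw) Xx.
  exists z => // u /set_mem Cu.
  have [->//|uv] := eqVneq u v; have [->//|uw] := eqVneq u w.
  have [side sideP] := G_bip.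
  move: (sideP _ _ (cC _ _ Cv Cw vw)) (sideP _ _ (cC _ _ Cu Cv uv)).
  move: (sideP _ _ (cC _ _ Cu Cw uw)).
  by case: (side u) (side v) (side w) => [] [] [].
have [w vw] := noniso v.
have [z Xz [zv _]] := fold_edge vw Xx.
exists z => // u /set_mem Cu; have [->//|uv] := eqVneq u v.
by case: noC; exists u; rewrite eq_sym.
Qed.

End FoldNonempty.

(* A strong fold of a nonempty constraint space can only be empty because of
   isolated vertices, on which [strongly_foldable] imposes no condition: there [a] may be the only
   symbol allowed.  Then every cocycle of X is Gibbs on the empty fold, so that
   the equivalence for X and its fold needs a nonempty fold. *)
Lemma fold_nonempty (G : graph) (A : finType) (X : set (config G A)) (a b : A) :
  bipartite G -> (forall v : G, exists w, adj v w) ->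
  nn_constraint_space X -> strongly_foldable X a b ->
  X !=set0 -> config_fold X a !=set0.
Proof.
move=> G_bip noniso X_nn ab [x Xx].
exists (fun v => if x v == a then b else x v); split; last first.
  move=> v /=; case: ifP => [_|/negbT //]; by rewrite eq_sym ab.1.
have [P P_clique XE] := X_nn; rewrite XE => p Pp px.
have [z] := fold_clique G_bip noniso ab (P_clique _ Pp) Xx.
rewrite XE => /(_ _ Pp) + zE; apply; rewrite /appears -[RHS]px.
by apply/funext => v; rewrite /restr; case: ifPn => // /zE ->.
Qed.

(* Main.v *)
Require Import Defs.
From mathcomp Require Import all_boot all_algebra.
From mathcomp Require Import all_classical all_reals.
From mathcomp Require Import ring lra.
Local Open Scope classical_set_scope.
Local Open Scope ring_scope.
Set Implicit Arguments.
Unset Strict Implicit.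
Unset Printing Implicit Defensive.
Import GRing.Theory.

(** If [M] is Gibbs on [X] then the same interaction works on the fold.  For
    the converse, interactions are peeled off: since Gibbs cocycles of
    invariant nearest neighbour interactions are themselves invariant Markov
    cocycles and are closed under addition, [M] is Gibbs as soon as [M] minus
    such a cocycle is ([gibbs_cocycles_peel]).  Three subtractions turn [M]
    into [0].

    The given interaction on the fold, extended by zero to patterns that do not
    occur in the fold, makes [M] vanish on the fold.  By the Markov property
    [M] then vanishes on every pair that shows no [a] on or next to the sites
    where it changes ([vanishes_away_from_a]), so all that is left to control
    is the replacement of a single [a] by [b].

    Let [x v = a].  Outside the ball of radius 1 around [v] one can change [x]
    so that it is [b] on the whole sphere of radius 2 ([fold_extension]), and
    by the Markov property this does not alter [M x x'], where [x'] is [x] with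
    [b] at [v].  Now the neighbours of [v] are pairwise non-adjacent and each
    sees only [v] and letters [b], so every letter that is allowed next to
    [a] at [v] can be put at a neighbour [w], independently of the other
    neighbours.  Changing the letter at [w] to [c] alters [M x x'], up to
    sign, by [square_defect M v w x c], the failure of the square (change [v],
    change [w]) to have [M] equal on parallel sides; and this depends only on
    the edge and on the letters at [w], because everything else around [w] is
    [b].  It can therefore be cancelled by an interaction on edges that carry an
    [a] at [v] ([edge_stage]).  On an edge whose two ends carry [a], the
    requirements coming from the two ends agree because the square is symmetric
    ([square_defectC]).

    Once all square defects vanish, the value on replacing [a] at [v] no longer
    depends on the neighbours of [v] ([removal_const]), and an interaction on
    single sites cancels it ([vertex_stage]).  The remaining cocycle vanishes
    whenever an [a] is removed and wherever there is no [a]; removing the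
    finitely many letters [a] in and around the sites where [x] and [y] differ
    shows that it is zero ([vertex_stage_vanishes]).

    Invariance under the group is built in: the values of the new interactions
    are selected from sets of reals that depend on the pattern in an
    equivariant way ([selected_invariant]).  The only place where this
    needs care is an isolated vertex, where folding says nothing about [b]:
    there any letter other than [a] may serve as replacement ([replaces]). *)

(** * Graphs and patterns *)

Section FiniteSets.

Lemma finite_subsets (T : eqType) (D : set T) :
  finite_set D -> finite_set [set B | B `<=` D].
Proof.
move=> /finite_seqP[s ->].
apply: (@sub_finite_set _ _
  ((fun m : (size s).-tuple bool => [set` mask m s]) @` setT)); last first.
  exact: finite_image finite_finset.
move=> B /= Bs.
have sz : size [seq x \in B | x <- s] == size s by rewrite size_map.
exists (Tuple sz) => //=; rewrite -filter_mask; apply/seteqP; split=> x /=.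
  by rewrite mem_filter => /andP[/set_mem].
by move=> Bx; rewrite mem_filter mem_set//=; exact: Bs.
Qed.

End FiniteSets.

Section Neighbourhoods.
Variable G : graph.
Implicit Types (F B : set G) (u v w : G).

Lemma finite_boundary F : finite_set F -> finite_set (boundary F).
Proof.
move=> Ff; apply: (@sub_finite_set _ _ (\bigcup_(v in F) [set w | adj v w])).
  by move=> u [_ [v Fv uv]]; exists v => //=; rewrite adj_sym.
by apply: bigcup_finite => // v _; exact: adj_locally_finite.
Qed.

Lemma clique_sub_nbhd F B v : is_clique B -> F v -> B v ->
  B `<=` F `|` boundary F.
Proof.
move=> [_ Bc] Fv Bv u Bu; have [Fu|nFu] := pselect (F u); [by left|right].
split=> //; exists v => //; apply: Bc => //.
by apply: contra_notP nFu => /negP/negPn/eqP->.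
Qed.

Lemma clique1 v : is_clique [set v].
Proof. by split=> [|u w /= -> ->]; [exact: finite_set1|rewrite eqxx]. Qed.

Lemma clique2 v w : adj v w -> is_clique [set v; w].
Proof.
move=> vw; split=> [|x y]; first exact: finite_set2.
by move=> /= [] -> [] -> //; rewrite ?eqxx// adj_sym.
Qed.

End Neighbourhoods.

Section Patterns.
Variables (G : graph) (A : finType).
Implicit Types (x y z : config G A) (p : pattern G A) (B : set G).
Implicit Types (X : set (config G A)) (g : graph_aut G).

Lemma restr_eqP B x y : {in B, x =1 y} <-> restr B x = restr B y.
Proof.
split=> [xy|e v vB]; last first.
  by move: (congr1 (@^~ v) e); rewrite /restr vB => -[].
by apply/funext => v; rewrite /restr; case: ifPn => // vB; rewrite xy.
Qed.

Lemma restr_in B x v : B v -> restr B x v = Some (x v).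
Proof. by move=> Bv; rewrite /restr mem_set. Qed.

Lemma pdom_restr B x : pdom (restr B x) = B.
Proof.
apply/seteqP; split=> v; rewrite /pdom /restr /=; case: ifPn => //.
  by move=> /set_mem.
by move=> /negP vB /mem_set.
Qed.

Lemma restr_inj B B' x x' : restr B x = restr B' x' ->
  B = B' /\ {in B, x =1 x'}.
Proof.
move=> e; have BB' : B = B' by rewrite -(pdom_restr B x) e pdom_restr.
by split=> //; apply/restr_eqP; rewrite e BB'.
Qed.

Lemma language_restr X B x : finite_set B -> X x -> language X (restr B x).
Proof. by move=> Bf Xx; exists B => //; exists x. Qed.

Lemma actKV (T : Type) g (x : G -> T) : act g (act g^-1%g x) = x.
Proof. by apply/funext => v; rewrite /act /= aut_finvK. Qed.

Lemma act_app (T : Type) g (x : G -> T) v : act g x (g v) = x v.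
Proof. by rewrite /act /= aut_funK. Qed.

Lemma mem_img g B v : (g v \in g @` B) = (v \in B).
Proof.
apply/idP/idP => /set_mem; last by move=> Bv; apply/mem_set; exists v.
by move=> [u Bu /(congr1 (aut_finv g))]; rewrite !aut_funK => <-; exact/mem_set.
Qed.

Lemma restr_act g B x : restr (g @` B) (act g x) = act g (restr B x).
Proof.
apply/funext => v; rewrite -(aut_finvK g v); set u := aut_finv g v.
by rewrite /restr act_app mem_img act_app.
Qed.

Lemma Delta_sym X x y : Delta X x y -> Delta X y x.
Proof.
move=> [Xx Xy xy]; split=> //; apply: sub_finite_set xy => v /= yx.
by rewrite /diff_sites /=; exact: nesym.
Qed.

Lemma Delta_refl X x : X x -> Delta X x x.
Proof.
by move=> Xx; split=> //; apply: sub_finite_set (@finite_set0 _) => v /=.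
Qed.

Lemma Delta_trans X x y z : Delta X x y -> Delta X y z -> Delta X x z.
Proof.
move=> [Xx _ xy] [_ Xz yz]; split=> //.
apply: (@sub_finite_set _ _ (diff_sites x y `|` diff_sites y z)).
  move=> v; rewrite /diff_sites /=.
  by have [->|xyv] := eqVneq (x v) (y v); [right|move=> _; left; exact/eqP].
by rewrite finite_setU.
Qed.

Section Invariance.
Variables (Gr : set (graph_aut G)) (Gr_group : group_closed (mem Gr)).

Lemma groupV g : Gr g -> Gr g^-1%g.
Proof.
move=> Gg; apply: set_mem; apply: (group_closedV Gr_group); exact: mem_set.
Qed.

Variables (X : set (config G A)) (X_inv : invariant_space Gr X).

Lemma act_space g x : Gr g -> X x -> X (act g x).
Proof. by move=> Gg Xx; rewrite -(X_inv Gg); exists x. Qed.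

Lemma act_language g p : Gr g -> language X p -> language X (act g p).
Proof.
move=> Gg [B Bf [x Xx <-]]; rewrite -restr_act.
by apply: language_restr; [exact: finite_image|exact: act_space].
Qed.

End Invariance.
End Patterns.

(** * Gibbs cocycles are Markov cocycles *)

Section GibbsCocycles.
Variables (R : realType) (G : graph) (A : finType).
Variables (X : set (config G A)).
Implicit Types (x y z : config G A) (U : pattern G A -> R) (B D : set G).

Let meeting D : set (set G) := [set B | is_clique B /\ B `&` D !=set0].

Lemma finite_meeting D : finite_set D -> finite_set (meeting D).
Proof.
move=> Df; have Nf : finite_set (D `|` boundary D).
  by rewrite finite_setU; split=> //; exact: finite_boundary.
apply: sub_finite_set (finite_subsets Nf) => B [Bc [v [Bv Dv]]].
exact: clique_sub_nbhd Bc Dv Bv.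
Qed.

Lemma gibbs_term0 U x y B : nn_interaction X U -> X x -> X y -> finite_set B ->
  ~ meeting (diff_sites x y) B -> U (restr B y) - U (restr B x) = 0.
Proof.
move=> Unn Xx Xy Bf nB; have [Bc|nBc] := pselect (is_clique B); last first.
  by rewrite !Unn ?subr0// ?pdom_restr//; exact: language_restr.
suff -> : restr B y = restr B x by rewrite subrr.
apply/restr_eqP => v /set_mem Bv; apply: contrapT => yx; apply: nB.
by split=> //; exists v; split=> //; exact: nesym.
Qed.

(** The sum defining a Gibbs cocycle ranges over infinitely many sets; all
    manipulations of it go through this finite form, with a [D] that may be
    shared by several pairs of configurations. *)
Lemma gibbs_meetingE U x y D : nn_interaction X U -> X x -> X y ->
  diff_sites x y `<=` D -> gibbs_cocycle U x y =
  \sum_(B \in meeting D) (U (restr B y) - U (restr B x)).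
Proof.
move=> Unn Xx Xy xyD; apply/esym/fsbig_widen => [B [[]]//|B /= [Bf nB]].
apply: gibbs_term0 => // -[Bc [v [Bv xyv]]].
by apply: nB; split=> //; exists v; split=> //; exact: xyD.
Qed.

Lemma gibbs_cat U x y z : nn_interaction X U -> Delta X x y -> Delta X y z ->
  gibbs_cocycle U x z = gibbs_cocycle U x y + gibbs_cocycle U y z.
Proof.
move=> Unn xy yz; have [Xx Xz xzf] := Delta_trans xy yz.
case: xy yz => _ Xy xyf [_ _ yzf].
pose D := diff_sites x y `|` diff_sites y z `|` diff_sites x z.
have Df : finite_set D by rewrite !finite_setU.
rewrite !(@gibbs_meetingE U _ _ D)//; try by move=> v ?; rewrite /D /=; tauto.
rewrite -fsbig_split; last exact: finite_meeting.
by apply: eq_fsbigr => B _ /=; ring.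
Qed.

Lemma gibbsD U U' x y : nn_interaction X U -> nn_interaction X U' ->
  Delta X x y -> gibbs_cocycle (fun p => U p + U' p) x y =
  gibbs_cocycle U x y + gibbs_cocycle U' x y.
Proof.
move=> Unn U'nn [Xx Xy xyf].
have UU'nn : nn_interaction X (fun p => U p + U' p).
  by move=> p pX pc; rewrite Unn ?U'nn ?addr0.
rewrite !(@gibbs_meetingE _ x y (diff_sites x y))//.
rewrite -fsbig_split; last exact: finite_meeting.
by apply: eq_fsbigr => B _ /=; ring.
Qed.

(** The tool for evaluating alternating sums of a Gibbs cocycle: when two
    changes of configuration agree on all cliques but one, only that clique
    is left in the difference. *)
Lemma gibbs_sub1 U x y x' y' B0 : nn_interaction X U -> finite_set B0 ->
  Delta X x y -> Delta X x' y' ->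
  (forall B, is_clique B -> B <> B0 -> U (restr B y) - U (restr B x) =
    U (restr B y') - U (restr B x')) ->
  gibbs_cocycle U x y - gibbs_cocycle U x' y' =
  (U (restr B0 y) - U (restr B0 x)) - (U (restr B0 y') - U (restr B0 x')).
Proof.
move=> Unn B0f [Xx Xy xyf] [Xx' Xy' xyf'] UB.
pose D := diff_sites x y `|` diff_sites x' y'.
have Df : finite_set D by rewrite !finite_setU.
(* [B0] is added because it need not meet the sites that change. *)
pose K := meeting D `|` [set B0].
have Kf : finite_set K.
  by rewrite finite_setU; split; [exact: finite_meeting|exact: finite_set1].
have gE z z' : X z -> X z' -> diff_sites z z' `<=` D -> gibbs_cocycle U z z' =
    \sum_(B \in K) (U (restr B z') - U (restr B z)).
  move=> Xz Xz' zD; rewrite (gibbs_meetingE _ _ _ zD)//.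
  apply: fsbig_widen => [B ?|B /= [[|->] nB]]//; first by left.
  apply: gibbs_term0 => // -[Bc [v [Bv zzv]]]; apply: nB.
  by split=> //; exists v; split=> //; exact: zD.
rewrite !gE//; try by move=> v ?; rewrite /D /=; tauto.
rewrite !(fsbigD1 B0 K)//; try by right.
rewrite [X in _ + X - _](eq_fsbigr
  (fun B => U (restr B y') - U (restr B x'))); first by rewrite /=; ring.
move=> B /set_mem[KB nB]; apply: UB => //.
by case: KB => [[]//|/nB].
Qed.

(** The equality holds term by term: a clique either misses the sites that
    change, and contributes nothing, or lies in their closed neighbourhood. *)
Lemma gibbs_markov U : nn_interaction X U -> markov X (gibbs_cocycle U).
Proof.
move=> Unn x y x' y' [Xx Xy xyf] [Xx' Xy' xyf'] F F' xx' yy'.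
apply: eq_fsbigr => B /set_mem /= Bf.
have [[Bc [v [Bv Fv]]]|nB] := pselect (meeting F B); last first.
  by rewrite !gibbs_term0// -/F ?F'.
have BF := clique_sub_nbhd Bc Fv Bv.
have e z z' : {in F `|` boundary F, z =1 z'} -> restr B z = restr B z'.
  by move=> zz'; apply/restr_eqP => u /set_mem/BF/mem_set/zz'.
by rewrite (e _ _ xx') (e _ _ yy').
Qed.

Section Invariance.
Variables (Gr : set (graph_aut G)) (Gr_group : group_closed (mem Gr)).
Variables (X_inv : invariant_space Gr X).

Lemma gibbs_invariant U : invariant_interaction Gr X U ->
  invariant_cocycle Gr X (gibbs_cocycle U).
Proof.
move=> Uinv g Gg x y [Xx Xy _].
rewrite /gibbs_cocycle (@reindex_fsbig _ _ _ _ _ (image^~ g)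
    [set B | finite_set B]); last first.
  split=> [B /= Bf|B B' _ _ /= e|B /= Bf]; first exact: finite_image.
  - have BB' v : (v \in B) = (v \in B') by rewrite -(mem_img g) e mem_img.
    by apply/seteqP; split=> v; rewrite -!(@in_setE _ _ v) BB'.
  - exists (aut_finv g @` B); first exact: finite_image.
    rewrite image_comp; apply/seteqP; split=> [_ [v Bv <-]/=|v Bv].
      by rewrite aut_finvK.
    by exists v => //=; rewrite aut_finvK.
apply: eq_fsbigr => B /set_mem /= Bf; rewrite !restr_act.
have UK z : X z -> U (act g (restr B z)) = U (restr B z).
  move=> Xz; rewrite -[in RHS](Uinv _ (groupV Gr_group Gg)) ?invgK//.
  exact: language_restr.
by rewrite !UK.
Qed.

Lemma markov_cocycles_sub_gibbs M U : markov_cocycles Gr X M ->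
  nn_interaction X U -> invariant_interaction Gr X U ->
  markov_cocycles Gr X (fun x y => M x y - gibbs_cocycle U x y).
Proof.
move=> [Mc Mm Mi] Unn Uinv; split.
- move=> x y z xy yz /=; rewrite (Mc _ _ _ xy yz) (gibbs_cat Unn xy yz); ring.
- move=> x y x' y' xy xy' F F' xx' yy'.
  by rewrite (Mm x y x' y')// (gibbs_markov Unn xy xy').
- by move=> g Gg x y xy; rewrite Mi// (gibbs_invariant Uinv).
Qed.

Lemma gibbs_cocycles_peel M U : nn_interaction X U ->
  invariant_interaction Gr X U ->
  gibbs_cocycles Gr X (fun x y => M x y - gibbs_cocycle U x y) ->
  gibbs_cocycles Gr X M.
Proof.
move=> Unn Uinv [V [Vnn Vinv MV]]; exists (fun p => V p + U p); split.
- by move=> p pX pc; rewrite Unn ?Vnn ?addr0.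
- by move=> g Gg p pX; rewrite Uinv ?Vinv.
- by move=> x y xy; rewrite gibbsD// -MV// subrK.
Qed.

End Invariance.
End GibbsCocycles.

(** * Changing and folding configurations *)

Section Updates.
Variables (G : graph) (A : finType).
Implicit Types (x y : config G A) (v w : G) (c d : A).

Definition upd x v c : config G A := fun u => if u == v then c else x u.

Lemma upd_same x v c : upd x v c v = c.
Proof. by rewrite /upd eqxx. Qed.

Lemma upd_other x v c u : u != v -> upd x v c u = x u.
Proof. by rewrite /upd => /negPf->. Qed.

Lemma upd_id x v : upd x v (x v) = x.
Proof. by apply/funext => u; rewrite /upd; case: eqP => // ->. Qed.

Lemma upd_upd x v c d : upd (upd x v c) v d = upd x v d.
Proof. by apply/funext => u; rewrite /upd; case: eqP. Qed.

Lemma updC x v w c d : v != w -> upd (upd x v c) w d = upd (upd x w d) v c.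
Proof.
move=> vw; apply/funext => u; rewrite /upd.
by have [->|//] := eqVneq u v; rewrite (negPf vw).
Qed.

Lemma diff_sites_upd x v c : diff_sites x (upd x v c) `<=` [set v].
Proof.
by move=> u; rewrite /diff_sites /upd /=; case: eqP.
Qed.

Lemma Delta_upd (X : set (config G A)) x v c :
  X x -> X (upd x v c) -> Delta X x (upd x v c).
Proof.
move=> Xx Xy; split=> //; apply: sub_finite_set (finite_set1 v).
exact: diff_sites_upd.
Qed.

Lemma act_upd (g : graph_aut G) x v c :
  act g (upd x v c) = upd (act g x) (g v) c.
Proof.
apply/funext => u; rewrite -(aut_finvK g u) /upd !act_app.
by rewrite (can_eq (aut_funK g)).
Qed.

Lemma adj_neq v w : adj v w -> v != w.
Proof. by apply: contraTneq => ->; rewrite adj_irr. Qed.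

End Updates.

Section Folding.
Variables (G : graph) (G_bip : bipartite G) (A : finType).
Variables (X : set (config G A)) (X_nn : nn_constraint_space X).
Implicit Types (x y z : config G A) (u v w : G) (c d : A).

Definition admissible v c w d := exists2 x, X x & x v = c /\ x w = d.

Lemma admissibleC v c w d : admissible v c w d -> admissible w d v c.
Proof. by move=> [x Xx []]; exists x. Qed.

Lemma admissible_in x v w : X x -> admissible v (x v) w (x w).
Proof. by exists x. Qed.

Lemma admissible_language v c w d : v != w ->
  language_on [set v; w] X (pat2 v c w d) <-> admissible v c w d.
Proof.
move=> vw; split=> -[x Xx].
  move=> e; exists x => //.
  move: (congr1 (@^~ v) e) (congr1 (@^~ w) e).
  rewrite /pat2 !eqxx eq_sym (negPf vw) !restr_in; [|by right|by left].
  by move=> [->] [->].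
move=> [<- <-]; exists x => //; apply/funext => u; rewrite /restr /pat2.
have [->|uv] := eqVneq u v; first by rewrite mem_set//; left.
have [->|uw] := eqVneq u w; first by rewrite mem_set//; right.
by rewrite memNset// => -[] /eqP; exact/negP.
Qed.

Lemma no_triangle u v w : adj u v -> adj v w -> adj w u -> False.
Proof.
have [side sideP] := G_bip => /sideP + /sideP + /sideP.
by case: (side u) (side v) (side w) => [] [] [].
Qed.

Lemma clique_cases (C : set G) : is_clique C ->
  [\/ C = set0, exists v, C = [set v] | exists v w, adj v w /\ C = [set v; w]].
Proof.
move=> [_ Cc]; have [->|/set0P[v Cv]] := eqVneq C set0; first exact: Or31.
have [[w [Cw vw]]|noC] := pselect (exists w, C w /\ v != w).
  apply: Or33; exists v, w; split; first exact: Cc.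
  apply/seteqP; split=> [u Cu|u [] -> //]; rewrite /=.
  have [->|uv] := eqVneq u v; first by left.
  have [->|uw] := eqVneq u w; first by right.
  by case: (@no_triangle u v w); apply: Cc => //; rewrite eq_sym.
apply: Or32; exists v; apply/seteqP; split=> [u Cu|u -> //]; rewrite /=.
by apply: contrapT => /eqP uv; apply: noC; exists u; rewrite eq_sym.
Qed.

(** In a bipartite graph a clique has at most two vertices, so membership in a
    nearest neighbour constraint space is tested on single sites and edges.
    Nonemptiness rules out that the empty pattern is forbidden. *)
Lemma space_glue y : X !=set0 ->
  (forall v w, v = w \/ adj v w -> admissible v (y v) w (y w)) -> X y.
Proof.
have [P Pc XE] := X_nn => -[z0 Xz0] yadm; rewrite {1}XE => p Pp py.
suff [x Xx px] : exists2 x, X x & appears p x.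
  by move: Xx; rewrite XE => /(_ _ Pp).
rewrite /appears -{}py in Pp *; rewrite pdom_restr.
case: (clique_cases (Pc _ Pp)); rewrite pdom_restr.
- by move=> ->; exists z0 => //; apply/restr_eqP => v; rewrite in_set0.
- move=> [v ->]; have [|x Xx [xv _]] := yadm v v; first by left.
  by exists x => //; apply/restr_eqP => u /set_mem ->.
- move=> [v [w [vw ->]]]; have [|x Xx [xv xw]] := yadm v w; first by right.
  by exists x => //; apply/restr_eqP => u /set_mem[]->.
Qed.

Lemma upd_space x v c : X x -> admissible v c v c ->
  (forall w, adj v w -> admissible v c w (x w)) -> X (upd x v c).
Proof.
move=> Xx vc cx; apply: space_glue; first by exists x.
move=> p q; rewrite /upd; have [->|pv pq] := eqVneq p v.
  have [-> //|qv [vq|]] := eqVneq q v; last exact: cx.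
  by rewrite vq eqxx in qv.
have [qv|//] := eqVneq q v; last by exists x.
apply: admissibleC; rewrite qv; apply: cx.
by case: pq => [pq|]; [rewrite pq qv eqxx in pv|rewrite adj_sym qv].
Qed.

Variables (a b : A) (ab : strongly_foldable X a b).

Lemma fold_sym v w c : adj v w -> admissible v a w c -> admissible v b w c.
Proof.
move=> vw; rewrite -!admissible_language ?adj_neq// => ac.
have wv : adj w v by rewrite adj_sym.
by have [] := ab.2 _ _ _ _ vw wv ac.
Qed.

Lemma fold_far v w u c : adj v w -> adj w u -> admissible v a w c ->
  admissible w c u b.
Proof.
move=> vw wu; rewrite -!admissible_language ?adj_neq// => ac.
by have [] := ab.2 _ _ _ _ vw wu ac.
Qed.

Lemma sphere2 v w u : adj v w -> adj w u -> u != v -> boundary (gball 1 v) u.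
Proof.
move=> vw wu uv; split; last first.
  by exists w; [exists [:: w]; rewrite //= vw|rewrite adj_sym].
move=> [[|p [|q s]] /= vp [pu]] //; first by rewrite pu eqxx in uv.
move=> _; rewrite andbT pu in vp.
by apply: (@no_triangle v w u) => //; rewrite adj_sym.
Qed.

(** The configuration [y] follows [x] on the ball of radius 1 around [v] and,
    outside, a configuration that is [b] on the sphere of radius 2.  The two
    fit together because every letter allowed next to [a] at [v] is allowed
    next to [b] on the far side. *)
Lemma fold_extension x v : X x -> x v = a -> exists y, [/\ X y, y v = a,
  forall w, adj v w -> y w = x w &
  forall w u, adj v w -> adj w u -> u != v -> y u = b].
Proof.
move=> Xx xv; have [[w0 vw0]|isov] := pselect (exists w, adj v w); last first.
  by exists x; split=> // w u vw; case: isov; exists w.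
have [z Xz zb] : exists2 z, X z &
    forall w u, adj v w -> adj w u -> u != v -> z u = b.
  have wv : adj w0 v by rewrite adj_sym.
  have [|_ _ [z Xz e]] := ab.2 v w0 v (x w0) vw0 wv.
    by apply/admissible_language; [exact: adj_neq|exists x].
  exists z => // w u vw wu uv; have ub := sphere2 vw wu uv.
  by move: (congr1 (@^~ u) e); rewrite restr_in// /const_pat mem_set// => -[].
pose D u := (u == v) || adj v u.
have far p q : D p -> ~~ D q -> adj p q -> admissible p (x p) q (z q).
  rewrite /D => /orP[/eqP->|vp]; first by case/norP => _ /negP.
  case/norP=> qv _ pq; rewrite (zb p q)//; apply: (fold_far vp) => //.
  by rewrite -xv; exact: admissible_in.
exists (fun u => if D u then x u else z u).
have XD : X (fun u => if D u then x u else z u).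
  apply: space_glue; first by exists x.
  move=> p q pq; case: ifPn => Dp; case: ifPn => Dq; rewrite ?Dp ?Dq.
  - exact: admissible_in.
  - by apply: far => //; case: pq => // pq; rewrite pq (negPf Dq) in Dp.
  - apply/admissibleC/far => //; rewrite adj_sym.
    by case: pq => // pq; rewrite -pq (negPf Dp) in Dq.
  - exact: admissible_in.
split=> //; rewrite /D.
- by rewrite eqxx.
- by move=> w vw; rewrite vw orbT.
- move=> w u vw wu uv; rewrite (negPf uv) /=; case: ifPn => [vu|_].
    by case: (@no_triangle v w u) => //; rewrite adj_sym.
  exact: zb wu uv.
Qed.

(** Letters that may take the place of [a] at [v].  At an isolated vertex [b]
    need not occur at all, and no other letter is distinguished in a way that
    the group respects, so all letters except [a] are taken there. *)
Definition replaces v d := d != a /\ forall w, adj v w -> d = b.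

Variables (z0 : config G A) (z0_fold : config_fold X a z0).

Definition base_letter v := if `[< exists w, adj v w >] then b else z0 v.

Lemma base_letter_replaces v : replaces v (base_letter v).
Proof.
rewrite /base_letter; case: ifPn => /asboolP vw; split=> //.
- by rewrite eq_sym; exact: ab.1.
- exact: z0_fold.2.
- by move=> w ?; case: vw; exists w.
Qed.

Definition foldOn (S : set G) x : config G A :=
  fun v => if (v \in S) && (x v == a) then base_letter v else x v.

(** Folding may be done at any set of sites at once, even an infinite one or
    one with adjacent letters [a]: on an edge the two ends are replaced one
    after the other. *)
Lemma foldOn_space S x : X x -> X (foldOn S x).
Proof.
move=> Xx; apply: space_glue; first by exists x.
have step v w c : adj v w -> admissible v (x v) w c ->
    admissible v (foldOn S x v) w c.
  rewrite /foldOn; case: ifPn => // /andP[_ /eqP->] vw /(fold_sym vw).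
  by rewrite /base_letter asboolT//; exists w.
move=> v w vw; have [[u vu]|isov] := pselect (exists u, adj v u).
  case: vw => [<-|vw].
    have [y Xy [yv _]] := step _ _ _ vu (admissible_in v u Xx).
    by exists y.
  apply/admissibleC/step; rewrite 1?adj_sym//.
  by apply/admissibleC/step => //; exact: admissible_in.
case: vw => [<-|vw]; last by case: isov; exists w.
rewrite /foldOn; case: ifPn => _; last by exists x.
by rewrite /base_letter asboolF//; exists z0 => //; exact: z0_fold.1.
Qed.

Lemma foldOn_neq S x v : S v -> foldOn S x v != a.
Proof.
move=> Sv; rewrite /foldOn mem_set//=; case: ifPn => [_|//].
exact: (base_letter_replaces v).1.
Qed.

Lemma foldOn_id S x v : x v != a -> foldOn S x v = x v.
Proof. by rewrite /foldOn => /negPf->; rewrite andbF. Qed.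

Lemma foldOn_cons w (s : seq G) x :
  foldOn [set` w :: s] x =
    if foldOn [set` s] x w == a then upd (foldOn [set` s] x) w (base_letter w)
    else foldOn [set` s] x.
Proof.
have [wa _] := base_letter_replaces w; have wN := negPf wa.
have mem_seqE (t : seq G) u : (u \in [set` t]) = (u \in t).
  by apply/idP/idP => [/set_mem|ut]; last exact/mem_set.
apply/funext => u; rewrite /foldOn !mem_seqE inE.
have [->|uw] /= := eqVneq u w.
  have [xw|xw] := eqVneq (x w) a; last first.
    by rewrite andbF /= (negPf xw) (negPf xw) andbF.
  rewrite andbT; case: (boolP (w \in s)) => ws.
    by rewrite wN mem_seqE ws xw eqxx.
  by rewrite xw eqxx upd_same.
case: ((if (w \in s) && _ then _ else _) =P a) => _; last by rewrite mem_seqE.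
by rewrite upd_other// mem_seqE.
Qed.

Lemma upd_base_space x v : X x -> x v = a -> X (upd x v (base_letter v)).
Proof.
move=> Xx xv; have := foldOn_space [set v] Xx; congr X; apply/funext => u.
rewrite /foldOn /upd; have [->|uv] := eqVneq u v.
  by rewrite xv eqxx mem_set.
by rewrite memNset//; exact/eqP.
Qed.

End Folding.

(** * Interactions selected from sets of values *)

Section SelectedInteractions.
Variables (R : realType) (G : graph) (A : finType).
Variables (X : set (config G A)) (Gr : set (graph_aut G)).
Variable Q : pattern G A -> set R.

Definition selected p : R := xget 0 (Q p).

Lemma selected_eq p r : Q p r -> (forall s, Q p s -> s = r) -> selected p = r.
Proof. exact: xget_unique. Qed.

Lemma selected_eq0 p : (forall r, Q p r -> r = 0) -> selected p = 0.
Proof. by rewrite /selected; case: xgetP => // r _ Qr /(_ _ Qr). Qed.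

Lemma selected_nn : (forall p r, Q p r -> is_clique (pdom p)) ->
  nn_interaction X selected.
Proof. by move=> Qc p _ pc; apply: selected_eq0 => r /Qc. Qed.

(** [xget] chooses by the set alone, so equal sets of candidates give equal
    values. *)
Lemma selected_invariant : group_closed (mem Gr) ->
  (forall g p r, Gr g -> Q p r -> Q (act g p) r) ->
  invariant_interaction Gr X selected.
Proof.
move=> Gr_group Qact g Gg p _; rewrite /selected; congr xget.
apply/seteqP; split=> r; last by apply: Qact; exact: groupV.
by move=> /(Qact _ _ _ Gg); rewrite actKV.
Qed.

End SelectedInteractions.

(** * The defect of an elementary square *)

Section Squares.
Variables (R : realType) (G : graph) (G_bip : bipartite G) (A : finType).
Variables (X : set (config G A)) (X_nn : nn_constraint_space X).
Variables (a b : A) (ab : strongly_foldable X a b).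
Implicit Types (x y z : config G A) (u v w : G) (c d : A).
Implicit Types (M : config G A -> config G A -> R).

(** The four configurations have [a] or [b] at [v] and the old letter or [c]
    at [w].  By the cocycle property this is also the amount by which the value
    on replacing [a] by [b] at [v] changes when the letter at [w] does. *)
Definition square_defect M v w x c : R :=
  M x (upd x w c) - M (upd x v b) (upd (upd x v b) w c).

(** What makes [x] the corner of a square in [X] for every letter [c] allowed at
    [w] next to [a] at [v]: with [b] at the other neighbours of [w], the letter
    at [w] can be chosen freely ([square_upd], [square_fold_upd]). *)
Definition square v w x := [/\ X x, x v = a, adj v w &
  forall u, adj w u -> u != v -> x u = b].

Lemma square_admissible v w x : square v w x -> admissible X v a w (x w).
Proof. by move=> [Xx xv _ _]; rewrite -xv; exists x. Qed.

Lemma square_upd v w x c : square v w x -> admissible X v a w c ->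
  square v w (upd x w c).
Proof.
move=> [Xx xv vw wb] ac; have nvw := adj_neq vw; split=> //; last 2 first.
- by rewrite upd_other.
- by move=> u wu uv; rewrite upd_other ?wb// eq_sym; exact: adj_neq.
apply: upd_space => //; first by have [y Xy [_ yw]] := ac; exists y.
move=> u wu; have [->|uv] := eqVneq u v.
  by rewrite xv; exact: admissibleC.
by rewrite wb//; exact: (fold_far ab vw wu ac).
Qed.

Lemma square_fold v w x : square v w x -> X (upd x v b).
Proof.
move=> [Xx xv vw _]; apply: upd_space => // [|u vu].
  have [|y Xy [yv _]] := fold_sym ab vw (c := x w).
    by rewrite -xv; exists x.
  by exists y.
by apply: (fold_sym ab vu); rewrite -xv; exists x.
Qed.

Lemma square_fold_upd v w x c : square v w x -> admissible X v a w c ->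
  X (upd (upd x v b) w c).
Proof.
move=> sx ac; have [_ _ vw _] := sx; rewrite updC ?adj_neq//.
exact/square_fold/square_upd.
Qed.

Section Cocycle.
Variables (M : config G A -> config G A -> R).
Variables (Mc : cocycle X M) (Mm : markov X M).

Lemma cocycle_refl x : X x -> M x x = 0.
Proof.
move=> /Delta_refl xx; have := Mc xx xx.
by rewrite -[LHS]addr0 => /addrI.
Qed.

Lemma markov_upd x x' v c : X x -> X x' -> X (upd x v c) -> X (upd x' v c) ->
  x v = x' v -> (forall w, adj v w -> x w = x' w) ->
  M x (upd x v c) = M x' (upd x' v c).
Proof.
move=> Xx Xx' Xy Xy' xv xN.
have dE y : diff_sites y (upd y v c) = [set u | u = v /\ y v <> c].
  apply/seteqP; split=> u; rewrite /diff_sites /upd /=.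
    by case: eqP => // ->.
  by move=> [->]; rewrite eqxx.
have xx' : {in diff_sites x (upd x v c) `|` boundary (diff_sites x (upd x v c)),
    x =1 x'}.
  rewrite dE => u /set_mem[[-> //]|[_ [_ [-> _] uv]]].
  by apply: xN; rewrite adj_sym.
apply: Mm => //; try exact: Delta_upd; first by rewrite !dE xv.
by move=> u /xx' e; rewrite /upd e.
Qed.

(** Both terms of the defect are changes at the single site [w], whose
    neighbours other than [v] all carry [b]. *)
Lemma square_defect_local v w x x' c : square v w x -> square v w x' ->
  x w = x' w -> admissible X v a w c ->
  square_defect M v w x c = square_defect M v w x' c.
Proof.
move=> sx sx' xw ac; have := adj_neq (let: And4 _ _ vw _ := sx in vw) => nvw.
have xx' u : adj w u -> x u = x' u.
  case: sx sx' => [_ xv vw xb] [_ x'v _ x'b] wu.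
  by have [->|uv] := eqVneq u v; [rewrite xv x'v|rewrite xb ?x'b].
congr (_ - _); apply: markov_upd => //.
- by case: sx.
- by case: sx'.
- by case: (square_upd sx ac).
- by case: (square_upd sx' ac).
- exact: (square_fold sx).
- exact: (square_fold sx').
- exact: square_fold_upd.
- exact: square_fold_upd.
- by rewrite !upd_other// eq_sym.
- by move=> u wu; rewrite /upd xx'.
Qed.

Lemma square_defect_cat v w x c c' : square v w x -> admissible X v a w c ->
  admissible X v a w c' -> square_defect M v w x c +
  square_defect M v w (upd x w c) c' = square_defect M v w x c'.
Proof.
move=> sx ac ac'; have [Xx _ vw _] := sx; have nvw := adj_neq vw.
have [Xc _ _ _] := square_upd sx ac; have [Xc' _ _ _] := square_upd sx ac'.
have Xb := square_fold sx.
have Xbc := square_fold_upd sx ac; have Xbc' := square_fold_upd sx ac'.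
rewrite /square_defect -(@updC _ _ x v w b c)// !upd_upd.
rewrite (Mc (Delta_upd Xx Xc) (y := upd x w c) (z := upd x w c')).
  rewrite (Mc (Delta_upd Xb Xbc) (z := upd (upd x v b) w c')); first ring.
  have := @Delta_upd _ _ X (upd (upd x v b) w c) w c'.
  by rewrite upd_upd; apply.
by have := @Delta_upd _ _ X (upd x w c) w c'; rewrite upd_upd; apply.
Qed.

Lemma square_defect_id v w x : square v w x -> square_defect M v w x (x w) = 0.
Proof.
move=> sx; have [Xx _ vw _] := sx.
have e : x w = upd x v b w by rewrite upd_other// eq_sym; exact: adj_neq.
rewrite /square_defect upd_id e upd_id !cocycle_refl ?subrr//.
exact: (square_fold sx).
Qed.

(** When both ends carry [a], extending [x] around [w] gives one configuration
    that can serve for both orientations of the edge, and then both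
    defects come from the two ways around the same square. *)
Lemma square_defectC v w x x' : square v w x -> square w v x' ->
  x w = a -> x' v = a ->
  square_defect M v w x b = square_defect M w v x' b.
Proof.
move=> sx sx' xw x'v; have [Xx xv vw xb] := sx; have nvw := adj_neq vw.
have wv : adj w v by rewrite adj_sym.
have aw : admissible X v a w b.
  apply/admissibleC/(fold_sym ab wv); rewrite -{1}xw -xv; by exists x.
have av : admissible X w a v b.
  apply/admissibleC/(fold_sym ab vw); rewrite -{1}xv -xw; by exists x.
have [y [Xy yw yN yb]] := fold_extension G_bip X_nn ab Xx xw.
have yv : y v = a by rewrite yN.
have sy : square v w y.
  by split=> // u wu uv; rewrite yN// xb.
have sy' : square w v y by split=> // u vu uw; exact: (yb _ _ wv vu uw).
rewrite (square_defect_local sx sy) ?xw//.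
rewrite (square_defect_local sx' sy') ?x'v// /square_defect.
have [Xyb _ _ _] := square_upd sy aw; have Xby := square_fold sy.
have Xbb := square_fold_upd sy aw.
have Dw := Mc (Delta_upd Xy Xyb) (z := upd (upd y w b) v b).
have Dv := Mc (Delta_upd Xy Xby) (z := upd (upd y v b) w b).
move: Dw Dv; rewrite (@updC _ _ y w v)// 1?eq_sym// => -> //; last first.
  by rewrite updC//; apply: Delta_upd => //; rewrite -updC.
move=> /(_ (Delta_upd Xby Xbb)) e.
lra.
Qed.

End Cocycle.
End Squares.

(** * The interaction on edges *)

Section Pairs.
Variable G : graph.
Implicit Types (u v w : G) (B : set G).

Lemma set2_inj v w v' w' : v != w -> v' != w' ->
  [set v; w] = [set v'; w'] -> (v = v' /\ w = w') \/ (v = w' /\ w = v').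
Proof.
move=> vw vw' e.
have : [set v'; w'] v by rewrite -e; left.
have : [set v'; w'] w by rewrite -e; right.
have : [set v; w] v' by rewrite e; left.
have : [set v; w] w' by rewrite e; right.
move=> /= [] ? [] ? [] ? [] ?; subst; rewrite ?eqxx// in vw vw' *;
  by [left|right].
Qed.

Lemma clique_with_edge (G_bip : bipartite G) B v w : is_clique B -> adj v w ->
  B v -> B w -> B = [set v; w].
Proof.
move=> [_ Bc] vw Bv Bw; apply/seteqP; split=> [u Bu|u [] -> //].
have [->|uv] := eqVneq u v; first by left.
have [->|uw] := eqVneq u w; first by right.
case: (@no_triangle _ G_bip u v w); [exact: Bc|exact: vw|].
by apply: Bc => //; rewrite eq_sym.
Qed.

End Pairs.

Section EdgeStage.
Variables (R : realType) (G : graph) (G_bip : bipartite G) (A : finType).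
Variables (Gr : set (graph_aut G)) (Gr_group : group_closed (mem Gr)).
Variables (X : set (config G A)) (X_nn : nn_constraint_space X).
Variables (X_inv : invariant_space Gr X).
Variables (a b : A) (ab : strongly_foldable X a b).
Variables (M : config G A -> config G A -> R).
Variables (MM : markov_cocycles Gr X M).
Implicit Types (x y z : config G A) (u v w : G) (c d : A) (p : pattern G A).
Implicit Types (g : graph_aut G).

(** Defects are measured relative to a reference letter at [w].  Preferring [b]
    has two effects: the letter is never [a], and for an edge that can carry
    [a] at both ends it is [b] for both orientations. *)
Definition reference_letter v w : option A :=
  if `[< admissible X v a w b >] then Some b
  else [pick c | `[< admissible X v a w c >]].

Lemma reference_letter_admissible v w c : reference_letter v w = Some c ->
  admissible X v a w c.
Proof.
rewrite /reference_letter; case: asboolP => [avb [<-] //|_].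
by case: pickP => // c' /asboolP ac' [<-].
Qed.

Lemma reference_letter_ex v w c : admissible X v a w c ->
  exists c0, reference_letter v w = Some c0.
Proof.
rewrite /reference_letter; case: asboolP => [|_ ac]; first by exists b.
by case: pickP => [c' _|/(_ c) /asboolP//]; exists c'.
Qed.

Lemma reference_letter_b v w c : reference_letter v w = Some c ->
  admissible X v a w b -> c = b.
Proof.
rewrite /reference_letter => /[swap] avb.
by rewrite asboolT// => -[].
Qed.

Lemma admissible_aab v w : adj v w -> admissible X v a w a ->
  admissible X v a w b.
Proof.
move=> vw /admissibleC aa; apply/admissibleC/(fold_sym ab) => //.
by rewrite adj_sym.
Qed.

Lemma reference_letter_neq v w c : adj v w -> reference_letter v w = Some c ->
  c != a.
Proof.
move=> vw e; have ac := reference_letter_admissible e.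
apply/eqP => ca; rewrite ca in ac.
have cb := reference_letter_b e (admissible_aab vw ac).
by have := ab.1; rewrite -ca cb eqxx.
Qed.

(** The value is minus the defect because the interaction enters the defect of
    its Gibbs cocycle through the starting configuration [x]; patterns with the
    reference letter at [w] are normalised to [0]. *)
Definition edge_value p : set R := fun r => exists v w x c,
  [/\ reference_letter v w = Some c, square X a b v w x,
      p = restr [set v; w] x & r = - square_defect b M v w x c].

Definition edge_interaction := selected edge_value.

(** A pattern determines the orientation of its edge unless both ends carry
    [a]; in that case the two orientations give the same value. *)
Lemma edge_interactionE v w x c : square X a b v w x ->
  reference_letter v w = Some c ->
  edge_interaction (restr [set v; w] x) = - square_defect b M v w x c.
Proof.
have [Mc Mm _] := MM.
move=> sx ec; have ac := reference_letter_admissible ec.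
apply: selected_eq; first by exists v, w, x, c.
move=> _ [v' [w' [x' [c' [ec' sx' /restr_inj[BB' xx'] ->]]]]].
congr (- _); apply/esym.
have [Xx xv vw xb] := sx; have [Xx' xv' vw' xb'] := sx'.
have xx'v : x v = x' v by apply: xx'; rewrite inE; left.
have xx'w : x w = x' w by apply: xx'; rewrite inE; right.
have [[e1 e2]|[e1 e2]] := set2_inj (adj_neq vw) (adj_neq vw') BB'.
  subst v' w'; have -> : c' = c by move: ec'; rewrite ec => -[].
  by apply: (square_defect_local G_bip X_nn ab Mm).
(* The orientation is reversed, hence both ends carry [a]. *)
subst v' w'; have xw : x w = a by rewrite xx'w.
have x'v : x' v = a by rewrite -xx'v.
have aa := square_admissible sx; rewrite xw in aa.
have aa' := square_admissible sx'; rewrite x'v in aa'.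
rewrite (reference_letter_b ec (admissible_aab vw aa)).
rewrite (reference_letter_b ec' (admissible_aab vw' aa')).
by apply: (square_defectC G_bip X_nn ab Mc Mm).
Qed.

Lemma edge_interaction_free B x : (forall v, B v -> x v != a) ->
  edge_interaction (restr B x) = 0.
Proof.
move=> xa; apply: selected_eq0 => r [v [w [x' [c [_ [_ x'v _ _] + _]]]]].
move=> /restr_inj[Be xx']; have Bv : B v by rewrite Be; left.
by have := xa _ Bv; rewrite xx' ?inE// x'v eqxx.
Qed.

Lemma edge_value_clique p r : edge_value p r -> is_clique (pdom p).
Proof.
move=> [v [w [x [c [_ [_ _ vw _] -> _]]]]]; rewrite pdom_restr.
exact: clique2.
Qed.

Lemma admissible_act g v w c d : Gr g ->
  admissible X (g v) c (g w) d <-> admissible X v c w d.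
Proof.
move=> Gg; split=> -[x Xx [<- <-]].
  exists (act g^-1%g x); first by apply: (act_space X_inv) => //; exact: groupV.
  by rewrite -!(act_app g (act _ x)) actKV.
by exists (act g x); [exact: (act_space X_inv)|rewrite !act_app].
Qed.

Lemma reference_letter_act g v w : Gr g ->
  reference_letter (g v) (g w) = reference_letter v w.
Proof.
move=> Gg; rewrite /reference_letter.
have e c : `[< admissible X (g v) a (g w) c >] = `[< admissible X v a w c >].
  by apply: asbool_equiv_eq; exact: admissible_act.
by rewrite e; congr (if _ then _ else _); exact: eq_pick.
Qed.

Lemma square_act g v w x : Gr g -> square X a b v w x ->
  square X a b (g v) (g w) (act g x).
Proof.
move=> Gg [Xx xv vw xb]; split.
- exact: (act_space X_inv).
- by rewrite act_app.
- by rewrite aut_adj.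
- move=> u; rewrite -(aut_finvK g u) aut_adj act_app => wu.
  by rewrite (can_eq (aut_funK g)); exact: xb.
Qed.

Lemma edge_value_act g p r : Gr g -> edge_value p r -> edge_value (act g p) r.
Proof.
have [_ _ Mi] := MM.
move=> Gg [v [w [x [c [ec sx -> ->]]]]];
exists (g v), (g w), (act g x), c; split.
- by rewrite reference_letter_act.
- exact: square_act.
- by rewrite -restr_act image_setU !image_set1.
have ac := reference_letter_admissible ec.
have [Xx _ _ _] := sx; have [Xc _ _ _] := square_upd G_bip X_nn ab sx ac.
rewrite /square_defect -!act_upd !Mi//; apply: Delta_upd => //.
  exact: (square_fold G_bip X_nn ab sx).
exact: (square_fold_upd G_bip X_nn ab sx ac).
Qed.

Lemma edge_interaction_nn : nn_interaction X edge_interaction.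
Proof. by apply: selected_nn; exact: edge_value_clique. Qed.

Lemma edge_interaction_invariant : invariant_interaction Gr X edge_interaction.
Proof. by apply: selected_invariant => // g p r; exact: edge_value_act. Qed.

(** In the double difference a clique cancels unless it contains both sites
    that change. *)
Lemma gibbs_square_defect (U : pattern G A -> R) v w x c : nn_interaction X U ->
  square X a b v w x -> admissible X v a w c ->
  square_defect b (gibbs_cocycle U) v w x c =
    (U (restr [set v; w] (upd x w c)) - U (restr [set v; w] x)) -
    (U (restr [set v; w] (upd (upd x v b) w c)) -
     U (restr [set v; w] (upd x v b))).
Proof.
move=> Unn sx ac; have [Xx xv vw xb] := sx.
have [Xc _ _ _] := square_upd G_bip X_nn ab sx ac.
have Xb := square_fold G_bip X_nn ab sx.
have Xbc := square_fold_upd G_bip X_nn ab sx ac.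
apply: (gibbs_sub1 Unn) => //; [exact: Delta_upd|exact: Delta_upd|].
move=> B Bc nB.
have restr_upd y u d : ~ B u -> restr B (upd y u d) = restr B y.
  move=> nBu; apply/restr_eqP => q /set_mem Bq; rewrite upd_other//.
  by apply/eqP => qu; rewrite qu in Bq.
have [Bw|nBw] := pselect (B w); last by rewrite !(restr_upd _ w)// !subrr.
have nBv : ~ B v by move=> Bv; exact/nB/(clique_with_edge G_bip).
by rewrite updC ?adj_neq// !(restr_upd _ v).
Qed.

Let M1 x y := M x y - gibbs_cocycle edge_interaction x y.

Lemma edge_stage_markov : markov_cocycles Gr X M1.
Proof.
by apply: markov_cocycles_sub_gibbs => //;
  [exact: edge_interaction_nn|exact: edge_interaction_invariant].
Qed.

Lemma edge_stage_reference v w x c : square X a b v w x ->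
  reference_letter v w = Some c -> square_defect b M1 v w x c = 0.
Proof.
have [Mc Mm _] := MM.
move=> sx ec; have ac := reference_letter_admissible ec.
have [Xx xv vw xb] := sx; have nvw := adj_neq vw.
have sc := square_upd G_bip X_nn ab sx ac.
have ca := reference_letter_neq vw ec; have ba := ab.1; rewrite eq_sym in ba.
suff <- : square_defect b M v w x c -
    square_defect b (gibbs_cocycle edge_interaction) v w x c = 0.
  by rewrite /square_defect /M1; ring.
rewrite gibbs_square_defect//; last exact: edge_interaction_nn.
rewrite (edge_interactionE sx ec) (edge_interactionE sc ec).
have e0 : square_defect b M v w (upd x w c) c = 0.
  by have := square_defect_id G_bip X_nn ab Mc sc; rewrite upd_same.
rewrite {}e0.
have e1 : edge_interaction (restr [set v; w] (upd (upd x v b) w c)) = 0.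
  apply: edge_interaction_free => u [] ->; last by rewrite upd_same.
  by rewrite upd_other// upd_same.
(* There may be an [a] left at [w]; then [v] carries [b], which is the
   reference letter for the reversed edge. *)
have e2 : edge_interaction (restr [set v; w] (upd x v b)) = 0.
  apply: selected_eq0 => r [v' [w' [x' [c' [ec' sx' /restr_inj[e xx'] ->]]]]].
  have x'v : x' v = b by rewrite -xx' ?upd_same// inE; left.
  have [_ x'v' vw' _] := sx'.
  have [[? ?]|[? ?]] := set2_inj nvw (adj_neq vw') e; subst v' w'.
    by rewrite -x'v x'v' eqxx in ba.
  have aw := square_admissible sx'; rewrite x'v in aw.
  have := square_defect_id G_bip X_nn ab Mc sx'; rewrite x'v.
  by rewrite (reference_letter_b ec' aw) => ->; rewrite oppr0.
rewrite e1 e2; ring.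
Qed.

(** Defects add up along successive changes at [w], so it is enough that they
    vanish for the change to the reference letter. *)
Lemma edge_stage v w x c : square X a b v w x -> admissible X v a w c ->
  square_defect b M1 v w x c = 0.
Proof.
move=> sx ac; have [c0 ec0] := reference_letter_ex ac.
have ac0 := reference_letter_admissible ec0.
have sc := square_upd G_bip X_nn ab sx ac; have [M1c _ _] := edge_stage_markov.
have := square_defect_cat G_bip X_nn ab M1c sx ac ac0.
by rewrite (edge_stage_reference sx ec0) (edge_stage_reference sc ec0) addr0.
Qed.

Lemma edge_stage_fold x y : Delta (config_fold X a) x y -> M1 x y = M x y.
Proof.
move=> [[_ xa] [_ ya] _]; rewrite /M1 /gibbs_cocycle fsbig1 ?subr0// => B _.
by rewrite !edge_interaction_free ?subrr.
Qed.

End EdgeStage.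

(** * The interaction on single sites *)

Section VertexStage.
Variables (R : realType) (G : graph) (G_bip : bipartite G) (A : finType).
Variables (Gr : set (graph_aut G)) (Gr_group : group_closed (mem Gr)).
Variables (X : set (config G A)) (X_nn : nn_constraint_space X).
Variables (X_inv : invariant_space Gr X).
Variables (a b : A) (ab : strongly_foldable X a b).
Variables (z0 : config G A) (z0_fold : config_fold X a z0).
Implicit Types (x y z : config G A) (u v w : G) (c d : A) (p : pattern G A).
Implicit Types (g : graph_aut G) (N : config G A -> config G A -> R).

(** Folding everywhere moves the pair into the fold without touching the letters
    that the Markov property looks at. *)
Lemma vanishes_away_from_a N x y : markov X N ->
  (forall x y, Delta (config_fold X a) x y -> N x y = 0) -> Delta X x y ->
  (forall v, (diff_sites x y `|` boundary (diff_sites x y)) v ->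
    x v != a /\ y v != a) -> N x y = 0.
Proof.
move=> Nm N0 xy xya; have [Xx Xy xyf] := xy.
pose f := foldOn a b z0 setT.
have Xf z : X z -> config_fold X a (f z).
  move=> Xz; split; first exact: (foldOn_space G_bip X_nn ab z0_fold).
  by move=> v; exact: (foldOn_neq ab z0_fold).
have dE : diff_sites (f x) (f y) = diff_sites x y.
  apply/seteqP; split=> v; rewrite /diff_sites /f /=.
    by apply: contra_not; rewrite /foldOn => ->.
  move=> xyv; have [|xv yv] := xya v; first by left.
  by rewrite !foldOn_id.
have fxy : Delta (config_fold X a) (f x) (f y).
  by split; [exact: Xf|exact: Xf|rewrite dE].
rewrite -[RHS](N0 _ _ fxy); apply: Nm => //.
- by case: fxy => -[? _] [? _].
- by move=> v /set_mem/xya[xv yv]; rewrite /f foldOn_id.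
- by move=> v /set_mem/xya[xv yv]; rewrite /f foldOn_id.
Qed.

Section RemovingOneA.
Variables (N : config G A -> config G A -> R) (NM : markov_cocycles Gr X N).
Hypothesis square0 : forall v w x c, square X a b v w x ->
  admissible X v a w c -> square_defect b N v w x c = 0.
Hypothesis fold0 : forall x y, Delta (config_fold X a) x y -> N x y = 0.

Let star v z := forall w, adj v w -> square X a b v w z.

(** Vanishing of the defect at [w] says that a change at [w] does not affect
    the value on replacing [a] at [v]. *)
Lemma star_upd v z w c : star v z -> adj v w -> admissible X v a w c ->
  star v (upd z w c) /\
  N (upd z w c) (upd (upd z w c) v b) = N z (upd z v b).
Proof.
move=> sz vw ac; have [Nc Nm _] := NM; have szw := sz _ vw.
have [Xz zv _ _] := szw; have [Xc zcv _ _] := square_upd G_bip X_nn ab szw ac.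
have Xb := square_fold G_bip X_nn ab szw; have nvw := adj_neq vw.
have Xbc := square_fold_upd G_bip X_nn ab szw ac.
split.
  move=> w' vw'; have [_ _ _ zb] := sz _ vw'; split=> // u w'u uv.
  rewrite upd_other; first exact: zb.
  apply/eqP => uw; rewrite uw in w'u.
  by apply: (@no_triangle _ G_bip v w' w) => //; rewrite adj_sym.
have := square0 szw ac; rewrite /square_defect.
have Ncb := Nc _ _ (upd (upd z w c) v b) (Delta_upd Xz Xc).
have Nbc := Nc _ _ (upd (upd z v b) w c) (Delta_upd Xz Xb).
move: Ncb; rewrite -updC// => /(_ _) Ncb.
have := Delta_upd Xc (c := b) (v := v); rewrite -updC// => /(_ Xbc) /Ncb {}Ncb.
have {}Nbc := Nbc (Delta_upd Xb Xbc).
lra.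
Qed.

Lemma star_walk v z y (s : seq G) : star v z -> X y -> y v = a ->
  {in s, forall w, adj v w} ->
  let z' := foldr (fun w t => upd t w (y w)) z s in
  star v z' /\ N z' (upd z' v b) = N z (upd z v b).
Proof.
move=> sz Xy yv; elim: s => [//|w s IHs] sN.
have [|sz' <-] := IHs; first by move=> u us; apply: sN; rewrite inE us orbT.
apply: star_upd => //; first by apply: sN; rewrite inE eqxx.
by rewrite -yv; exists y.
Qed.

(** If [v] has neighbours, both configurations are first made equal to [b] on
    the sphere of radius 2, and then the neighbours of [v] are changed one at
    a time from the letters of [x] to those of [x'].  If [v] is isolated, only
    the letters [d] and [d'] matter, and both are different from [a]. *)
Lemma removal_const v x x' d d' : X x -> X x' -> x v = a -> x' v = a ->
  replaces a b v d -> replaces a b v d' ->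
  X (upd x v d) -> X (upd x' v d') ->
  N x (upd x v d) = N x' (upd x' v d').
Proof.
move=> Xx Xx' xv x'v [da db] [da' db'] Xd Xd'; have [Nc Nm _] := NM.
have [[w vw]|isov] := pselect (exists w, adj v w).
  rewrite (db _ vw) in Xd *; rewrite (db' _ vw) in Xd' *.
  have [y [Xy yv yN yb]] := fold_extension G_bip X_nn ab Xx xv.
  have [y' [Xy' yv' yN' yb']] := fold_extension G_bip X_nn ab Xx' x'v.
  have sy : star v y by move=> u vu; split=> // q; exact: yb.
  have /finite_seqP[s sE] := adj_locally_finite v.
  have sN : {in s, forall u, adj v u}.
    by move=> u us; have : [set` s] u by []; rewrite -sE.
  have [sy' e] := star_walk sy Xy' yv' sN.
  have Xyb := square_fold G_bip X_nn ab (sy _ vw).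
  rewrite (markov_upd Nm Xx Xy Xd Xyb) ?xv//; last by move=> u /yN.
  rewrite -e; have szw := sy' _ vw; have [Xz zv _ _] := szw.
  apply: (markov_upd Nm Xz Xx' (square_fold G_bip X_nn ab szw) Xd').
    by rewrite zv.
  move=> u vu; rewrite -yN'//; have {vu} : u \in s.
    by have : [set` s] u by rewrite -sE.
  elim: s {sE sN sy' e szw Xz zv} => //= q s IHs.
  by rewrite inE /upd; case: eqP => [->//|_ /=].
have Xd2 : X (upd x' v d).
  apply: (upd_space G_bip X_nn Xx') => [|u vu]; last by case: isov; exists u.
  by exists (upd x v d) => //; rewrite upd_same.
rewrite (markov_upd Nm Xx Xx' Xd Xd2) ?xv//; last first.
  by move=> u vu; case: isov; exists u.
have dd : Delta X (upd x' v d) (upd x' v d').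
  by rewrite -(upd_upd x' v d d'); apply: Delta_upd; rewrite ?upd_upd.
rewrite (Nc _ _ _ (Delta_upd Xx' Xd2) dd).
rewrite (vanishes_away_from_a Nm fold0 dd) ?addr0//.
have sub : diff_sites (upd x' v d) (upd x' v d') `<=` [set v].
  by rewrite -(upd_upd x' v d d'); exact: diff_sites_upd.
move=> u [/sub ->|[_ [q /sub -> uv]]]; first by rewrite !upd_same.
by case: isov; exists u; rewrite adj_sym.
Qed.

Definition vertex_value p : set R := fun r => exists v x d,
  [/\ X x /\ x v = a, X (upd x v d), replaces a b v d,
      p = restr [set v] x & r = - N x (upd x v d)].

Definition vertex_interaction := selected vertex_value.

Lemma vertex_interactionE v x d : X x -> x v = a -> X (upd x v d) ->
  replaces a b v d -> vertex_interaction (restr [set v] x) = - N x (upd x v d).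
Proof.
move=> Xx xv Xd vd; apply: selected_eq; first by exists v, x, d.
move=> _ [v' [x' [d' [[Xx' x'v] Xd' vd' /restr_inj[e _] ->]]]]; congr (- _).
have ? : v' = v by apply: (_ : [set v] v'); rewrite e.
by subst v'; exact: removal_const.
Qed.

Lemma vertex_value_site B x r : vertex_value (restr B x) r ->
  exists2 v, B = [set v] & x v = a.
Proof.
move=> [v [x' [d [[_ x'v] _ _ /restr_inj[Be xx'] _]]]]; exists v => //.
by rewrite xx' ?Be// inE.
Qed.

Lemma vertex_interaction_free B x : (forall v, B v -> x v != a) ->
  vertex_interaction (restr B x) = 0.
Proof.
move=> xa; apply: selected_eq0 => r /vertex_value_site[v Bv xv].
by have := xa v; rewrite Bv xv eqxx => /(_ erefl).
Qed.

Lemma replaces_act g v d : replaces a b v d -> replaces a b (g v) d.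
Proof.
move=> [da db]; split=> // w; rewrite -(aut_finvK g w) aut_adj; exact: db.
Qed.

Lemma vertex_interaction_nn : nn_interaction X vertex_interaction.
Proof.
apply: selected_nn => p r [v [x [d [_ _ _ -> _]]]]; rewrite pdom_restr.
exact: clique1.
Qed.

Lemma vertex_interaction_invariant :
  invariant_interaction Gr X vertex_interaction.
Proof.
apply: selected_invariant => // g p r Gg [v [x [d [[Xx xv] Xd vd -> ->]]]].
have [_ _ Ni] := NM; exists (g v), (act g x), d; split.
- by split; [exact: (act_space X_inv)|rewrite act_app].
- by rewrite -act_upd; exact: (act_space X_inv).
- exact: replaces_act.
- by rewrite -restr_act image_set1.
- by rewrite -act_upd Ni//; exact: Delta_upd.
Qed.

Let N1 x y := N x y - gibbs_cocycle vertex_interaction x y.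

Lemma vertex_stage_markov : markov_cocycles Gr X N1.
Proof.
by apply: markov_cocycles_sub_gibbs => //;
  [exact: vertex_interaction_nn|exact: vertex_interaction_invariant].
Qed.

Lemma vertex_stage v x d : X x -> x v = a -> X (upd x v d) ->
  replaces a b v d -> N1 x (upd x v d) = 0.
Proof.
move=> Xx xv Xd vd; have xd := Delta_upd Xx Xd.
have xx := Delta_refl Xx.
have g0 : gibbs_cocycle vertex_interaction x x = 0.
  by rewrite /gibbs_cocycle fsbig1// => B _; rewrite subrr.
have := @gibbs_sub1 _ _ _ _ _ _ _ _ _ [set v] vertex_interaction_nn
  (finite_set1 v) xd xx.
rewrite g0 subr0 /N1 => ->; last first.
  move=> B Bc nB; have [Bv|nBv] := pselect (B v).
    suff U0 z : vertex_interaction (restr B z) = 0 by rewrite !U0.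
    apply: selected_eq0 => r /vertex_value_site[u Bu _].
    by case: nB; rewrite Bu in Bv *; rewrite Bv.
  rewrite subrr; apply/eqP; rewrite subr_eq0; apply/eqP.
  congr vertex_interaction.
  apply/restr_eqP => q /set_mem Bq; rewrite upd_other//.
  by apply/eqP => qv; rewrite qv in Bq.
rewrite (vertex_interactionE Xx xv Xd vd) vertex_interaction_free; first ring.
by move=> u ->; rewrite upd_same; exact: vd.1.
Qed.

Lemma vertex_stage_fold x y : Delta (config_fold X a) x y -> N1 x y = 0.
Proof.
move=> xy; have [[_ xa] [_ ya] _] := xy.
rewrite /N1 fold0// sub0r /gibbs_cocycle fsbig1 ?oppr0// => B _.
by rewrite !vertex_interaction_free ?subrr.
Qed.

Lemma fold_seq_vanishes x (s : seq G) : X x ->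
  Delta X x (foldOn a b z0 [set` s] x) /\ N1 x (foldOn a b z0 [set` s] x) = 0.
Proof.
move=> Xx; have [N1c _ _] := vertex_stage_markov.
elim: s => [|w s [IHD IH0]].
  have -> : foldOn a b z0 [set` [::]] x = x.
    by apply/funext => u; rewrite /foldOn memNset.
  by split; [exact: Delta_refl|exact: (cocycle_refl N1c)].
set y := foldOn a b z0 [set` s] x in IHD IH0 *.
have [_ Xy _] := IHD.
rewrite (foldOn_cons ab z0_fold) -/y.
case: ifPn => [/eqP yw|_//].
have Xyw := upd_base_space G_bip X_nn ab z0_fold Xy yw.
have yyw := Delta_upd Xy Xyw.
split; first exact: Delta_trans yyw.
rewrite (N1c _ _ _ IHD yyw) IH0 add0r vertex_stage//.
exact: (base_letter_replaces ab z0_fold).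
Qed.

Lemma vertex_stage_vanishes x y : Delta X x y -> N1 x y = 0.
Proof.
move=> xy; have [Xx Xy xyf] := xy.
have [N1c N1m _] := vertex_stage_markov.
pose F := diff_sites x y.
(* Folding on [F] alone would leave letters [a] next to the sites of change. *)
have /finite_seqP[s sE] : finite_set (F `|` boundary F).
  by rewrite finite_setU; split=> //; exact: finite_boundary.
have [xfx fx0] := fold_seq_vanishes s Xx.
have [yfy fy0] := fold_seq_vanishes s Xy.
rewrite -sE in xfx fx0 yfy fy0.
set fx := foldOn _ _ _ _ x in xfx fx0.
set fy := foldOn _ _ _ _ y in yfy fy0.
have fxfy := Delta_trans (Delta_trans (Delta_sym xfx) xy) yfy.
have fxy0 : N1 fx fy = 0.
  apply: (vanishes_away_from_a N1m vertex_stage_fold) => // v.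
  have sub : diff_sites fx fy `<=` F.
    by move=> u; apply: contra_not => e; rewrite /fx /fy /foldOn e.
  move=> fv; have Fv : (F `|` boundary F) v.
    have [|nFv] := pselect (F v); first by left.
    case: fv => [/sub//|[_ [u /sub Fu uv]]].
    by right; split=> //; exists u.
  by split; exact: (foldOn_neq ab z0_fold).
have := N1c _ _ _ xy yfy; rewrite fy0 addr0 => <-.
by rewrite (N1c _ _ _ xfx fxfy) fx0 fxy0 addr0.
Qed.

Lemma vertex_stage_gibbs : gibbs_cocycles Gr X N.
Proof.
apply: (gibbs_cocycles_peel vertex_interaction_nn vertex_interaction_invariant).
exists (fun=> 0); split=> // x y xy.
rewrite [LHS]vertex_stage_vanishes// /gibbs_cocycle fsbig1// => B _.
by rewrite subrr.
Qed.

End RemovingOneA.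
End VertexStage.

(** * Peeling off the interaction of the fold *)

Section Extension.
Variables (R : realType) (G : graph) (A : finType).
Variables (Gr : set (graph_aut G)) (Gr_group : group_closed (mem Gr)).
Variables (X Y : set (config G A)) (Y_inv : invariant_space Gr Y).
Variable U : pattern G A -> R.

Definition extend_interaction p : R := if `[< language Y p >] then U p else 0.

Lemma extend_interaction_nn : nn_interaction Y U ->
  nn_interaction X extend_interaction.
Proof.
by move=> Unn p _ pc; rewrite /extend_interaction; case: asboolP => // /Unn ->.
Qed.

Lemma extend_interaction_invariant : invariant_interaction Gr Y U ->
  invariant_interaction Gr X extend_interaction.
Proof.
move=> Uinv g Gg p _; rewrite /extend_interaction.
case: asboolP => Yp; case: asboolP => Yp'.
- exact: Uinv.
- by case: Yp'; rewrite -(actKV g p); exact: (act_language Y_inv).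
- by case: Yp; apply: (act_language Y_inv) => //; exact: groupV.
- by [].
Qed.

Lemma gibbs_extend_interaction x y : Y x -> Y y ->
  gibbs_cocycle extend_interaction x y = gibbs_cocycle U x y.
Proof.
move=> Yx Yy; apply: eq_fsbigr => B /set_mem /= Bf.
by rewrite /extend_interaction !asboolT//; exact: language_restr.
Qed.

End Extension.

Lemma config_fold_invariant (G : graph) (A : finType) (X : set (config G A))
    (Gr : set (graph_aut G)) (a : A) : group_closed (mem Gr) ->
  invariant_space Gr X -> invariant_space Gr (config_fold X a).
Proof.
move=> Gr_group X_inv g Gg.
have act_fold h x : Gr h -> config_fold X a x -> config_fold X a (act h x).
  by move=> Gh [Xx xa]; split=> [|v]; [exact: (act_space X_inv)|exact: xa].
apply/seteqP; split=> [_ [x Yx <-]|x Yx]; first exact: act_fold.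
by exists (act g^-1%g x); [apply: act_fold => //; exact: groupV|exact: actKV].
Qed.

Lemma gibbs_cocycles_sub (R : realType) (G : graph) (A : finType)
    (Gr : set (graph_aut G)) (X Y : set (config G A)) : Y `<=` X ->
  @gibbs_cocycles R G A Gr X `<=` gibbs_cocycles Gr Y.
Proof.
move=> YX M [U [Unn Uinv MU]].
have LYX : language Y `<=` language X.
  by move=> p [B Bf [x Yx <-]]; exists B => //; exists x => //; exact: YX.
exists U; split=> [p /LYX|g Gg p /LYX|x y [/YX Xx /YX Xy xy]].
- exact: Unn.
- exact: Uinv.
- exact: MU.
Qed.

Theorem theorem4p6 (R : realType) (G : graph) (G_bipartite : bipartite G)
    (A : finType) (Gr : set (graph_aut G)) (Gr_group : group_closed (mem Gr))
    (X : set (config G A)) (X_nn : nn_constraint_space X)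
    (X_inv : invariant_space Gr X)
    (a : A) (a_folds : exists b : A, strongly_foldable X a b)
    (X_fold_neq0 : X !=set0 -> config_fold X a !=set0)
    (M : config G A -> config G A -> R) (M_markov : markov_cocycles Gr X M) :
  gibbs_cocycles Gr X M <-> gibbs_cocycles Gr (config_fold X a) M.
Proof.
split; first by apply: gibbs_cocycles_sub => x [].
move=> [U [Unn Uinv MU]]; have [b ab] := a_folds.
have [[x0 Xx0]|X0] := pselect (X !=set0); last first.
  exists (fun=> 0); split=> // x y [Xx _ _].
  by case: X0; exists x.
have [|z0 z0_fold] := X_fold_neq0; first by exists x0.
have Y_inv : invariant_space Gr (config_fold X a).
  exact: config_fold_invariant.
pose U0 := extend_interaction (config_fold X a) U.
have U0nn : nn_interaction X U0 by exact: extend_interaction_nn.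
have U0inv : invariant_interaction Gr X U0.
  exact: extend_interaction_invariant.
apply: (gibbs_cocycles_peel U0nn U0inv).
have M0M := markov_cocycles_sub_gibbs Gr_group M_markov U0nn U0inv.
set M0 := (fun x y => _) in M0M *.
have M00 x y : Delta (config_fold X a) x y -> M0 x y = 0.
  move=> xy; have [Yx Yy _] := xy.
  by rewrite /M0 gibbs_extend_interaction// -MU// subrr.
apply: (gibbs_cocycles_peel (edge_interaction_nn a b M0)
  (edge_interaction_invariant G_bipartite Gr_group X_nn X_inv ab M0M)).
apply: (vertex_stage_gibbs G_bipartite Gr_group X_nn X_inv ab z0_fold).
- exact: edge_stage_markov.
- by move=> v w x c; exact: (edge_stage G_bipartite Gr_group X_nn X_inv ab M0M).
- by move=> x y xy; exact: etrans (edge_stage_fold b M0 xy) (M00 x y xy).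
Qed.
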